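(* Let $d=mk\ge3$, $p=1+\frac1{\ln(d)}$, $q=\frac{p}{p-1}=1+\ln(d)$. Consider the closed-loop system, for $t\in\mathbb{Z}_+$, $$X_{t+1}=\mathcal{A}(X_t)+\mathcal{B}\bigl(\Theta\Psi(X_t,t)+U_t\bigr),\qquad U_t=-\mathcal{K}(X_t)-\widehat{\Theta}_t\Psi(X_t,t)+U_t^{\mathrm d},$$ with arbitrary initial state $X_0\in\mathbb{R}^{n_1\times n_2}$, where $\widehat\Theta_0=0$ and $$\widehat{\Theta}_{t+1}=\nabla f^*_{\ell_p}\bigl(\nabla f_{\ell_p}(\widehat{\Theta}_t)-\eta_{t+1}\nabla J_t(\widehat{\Theta}_t)\bigr),\qquad \eta_{t+1}=\frac{2J_t(\widehat{\Theta}_t)}{\epsilon_{t+1}+\|\nabla J_t(\widehat{\Theta}_t)\|_\infty^2},$$ for a nonnegative bounded sequence $\{\epsilon_{t+1}\}_{t\in\mathbb{Z}_+}$. Suppose that $\Theta\in\mathbb{R}^{m\times k}$ has at most $s$ nonzero entries, where $s$ is a positive integer. Then for every integer $T\ge1$ the regret $\operatorname{Reg}(T):=\sum_{t=0}^{T-1}J_t(\widehat\Theta_t)$ satisfies $$\operatorname{Reg}(T)\le\frac e2\,s^{\frac{\ln(d)}{1+\ln(d)}}\,\|\Theta\|_\infty\sqrt{\ln(d)\sum_{t=0}^{T-1}\left(\epsilon_{t+1}+\|\nabla J_t(\widehat\Theta_t)\|_\infty^2\right)} .$$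
   Context: Fix positive integers $n_1,n_2,m,k$. Matrix spaces carry the Frobenius inner product $\langle X,Y\rangle=\operatorname{Tr}(X^\top Y)$ and Frobenius norm $\|\cdot\|_{\mathrm F}$. $\mathcal{A}:\mathbb{R}^{n_1\times n_2}\to\mathbb{R}^{n_1\times n_2}$, $\mathcal{B}:\mathbb{R}^{m\times n_2}\to\mathbb{R}^{n_1\times n_2}$ and $\mathcal{K}:\mathbb{R}^{n_1\times n_2}\to\mathbb{R}^{m\times n_2}$ are linear operators such that $\mathcal{A}-\mathcal{B}\mathcal{K}$ (i.e. $X\mapsto\mathcal{A}(X)-\mathcal{B}(\mathcal{K}(X))$) is Schur stable (spectral radius $<1$). $\mathcal{B}^\top$ is the adjoint of $\mathcal{B}$: $\langle\mathcal{B}(U),V\rangle=\langle U,\mathcal{B}^\top(V)\rangle$. $\Psi:\mathbb{R}^{n_1\times n_2}\times\mathbb{Z}_+\to\mathbb{R}^{k\times n_2}$ is a map (the regressor), $\{U_t^{\mathrm d}\}_{t\in\mathbb{Z}_+}\subset\mathbb{R}^{m\times n_2}$ is a bounded sequence, and $\Theta\in\mathbb{R}^{m\times k}$ is the fixed true parameter. Residual, loss and gradient: $$\widetilde X_{t+1}:=X_{t+1}-(\mathcal{A}-\mathcal{B}\mathcal{K})(X_t)-\mathcal{B}(U_t^{\mathrm d})=\mathcal{B}\bigl((\Theta-\widehat\Theta_t)\Psi(X_t,t)\bigr),$$ $$J_t(\widehat\Theta_t):=\tfrac12\bigl\|\mathcal{B}\bigl((\Theta-\widehat\Theta_t)\Psi(X_t,t)\bigr)\bigr\|_{\mathrm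 F}^2=\tfrac12\|\widetilde X_{t+1}\|_{\mathrm F}^2,\qquad \nabla J_t(\widehat\Theta_t)=-\mathcal{B}^\top(\widetilde X_{t+1})\Psi(X_t,t)^\top .$$ For a matrix $Q$, $\|Q\|_p=(\sum_{i,j}|Q_{ij}|^p)^{1/p}$ and $\|Q\|_\infty=\max_{i,j}|Q_{ij}|$ are entrywise norms. The mirror map is $f_{\ell_p}(Q)=\frac{d^{2-2/p}}{2(p-1)}\|Q\|_p^2$ on $\mathbb{R}^{m\times k}$, with Fenchel conjugate $f_{\ell_p}^*$; explicitly $$\nabla f_{\ell_p}(Q)=\frac{d^{2-2/p}}{p-1}\|Q\|_p^{2-p}\operatorname{sign}(Q)\odot|Q|^{p-1},\qquad \nabla f_{\ell_p}^*(Z)=\frac{p-1}{d^{2-2/p}}\|Z\|_q^{2-q}\operatorname{sign}(Z)\odot|Z|^{q-1},$$ with sign, absolute value and powers taken entrywise, $\odot$ the Hadamard product, and both gradients equal to $0$ at $0$. Convention: if the denominator in the step size is zero (in which case $J_t(\widehat\Theta_t)=0$ too), set $\eta_{t+1}=0$. *)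

(* Defs.v *)
From HB Require Import structures.
From mathcomp Require Import all_boot all_order all_algebra.
From mathcomp Require Import all_classical all_reals all_analysis.
From mathcomp Require Import complex ring.

Set Implicit Arguments.
Unset Strict Implicit.
Unset Printing Implicit Defensive.

Import Order.TTheory GRing.Theory Num.Theory.
Import numFieldNormedType.Exports.

Local Open Scope classical_set_scope.
Local Open Scope ring_scope.

Definition mxdot (R : realType) (a b : nat) (X Y : 'M[R]_(a, b)) : R :=
  \tr (X^T *m Y).

Definition frob (R : realType) (a b : nat) (X : 'M[R]_(a, b)) : R :=
  Num.sqrt (mxdot X X).

(* The entrywise max-norm needs no definition: it is MathComp-Analysis'
   canonical norm `|Q| on matrices, see [mx_normrE]. *)
Definition lp_norm (R : realType) (a b : nat) (p : R) (Q : 'M[R]_(a, b)) : R :=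
  (\sum_i \sum_j `|Q i j| `^ p) `^ p^-1.

(* The complex modulus is taken as the real number [Normc.normc]. *)
Definition spectral_radius (R : realType) (n : nat) (M : 'M[R]_n) : R :=
  sup [set Normc.normc z | z in
        [set z | eigenvalue (map_mx (real_complex R) M) z]].

(* [lin_mx F] is the matrix of F acting on vectorized (flattened) matrices. *)
Definition schur_stable (R : realType) (a b : nat)
    (F : 'M[R]_(a, b) -> 'M[R]_(a, b)) : Prop :=
  spectral_radius (lin_mx F) < 1.

(* Gradient with respect to [mxdot]: the matrix of partial derivatives. *)
Definition grad (R : realType) (a b : nat) (F : 'M[R]_(a, b) -> R)
    (Q : 'M[R]_(a, b)) : 'M[R]_(a, b) :=
  \matrix_(i, j) 'D_(delta_mx i j) (F : 'M[R]_(a, b) -> R^o) Q.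

(* Real-valued: only meaningful where the supremum is finite, which is the case
   everywhere for [mirror p] with 1 < p, as it is a positive multiple of the
   square of a norm. *)
Definition fenchel (R : realType) (a b : nat) (F : 'M[R]_(a, b) -> R)
    (Z : 'M[R]_(a, b)) : R :=
  sup [set mxdot Q Z - F Q | Q in [set: 'M[R]_(a, b)]].

Definition mirror (R : realType) (a b : nat) (p : R) (Q : 'M[R]_(a, b)) : R :=
  (a * b)%:R `^ (2 - 2 / p) / (2 * (p - 1)) * lp_norm p Q ^+ 2.

(* [psi] stands for the regressor value at the current state and time, [Q] for
   the parameter estimate. *)
Definition loss (R : realType) (n1 n2 m k : nat)
    (B : 'M[R]_(m, n2) -> 'M[R]_(n1, n2)) (Theta : 'M[R]_(m, k))
    (psi : 'M[R]_(k, n2)) (Q : 'M[R]_(m, k)) : R :=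
  frob (B ((Theta - Q) *m psi)) ^+ 2 / 2.

Lemma mxdotE (R : realType) (a b : nat) (X Y : 'M[R]_(a, b)) :
  mxdot X Y = \sum_i \sum_j X i j * Y i j.
Proof.
rewrite /mxdot /mxtrace exchange_big /=; apply: eq_bigr => j _.
by rewrite mxE; apply: eq_bigr => i _; rewrite mxE.
Qed.

Lemma mxdotC (R : realType) (a b : nat) (X Y : 'M[R]_(a, b)) :
  mxdot X Y = mxdot Y X.
Proof.
by rewrite !mxdotE; apply: eq_bigr => i _; apply: eq_bigr => j _; rewrite mulrC.
Qed.

Lemma mxdot_ge0 (R : realType) (a b : nat) (X : 'M[R]_(a, b)) : 0 <= mxdot X X.
Proof.
rewrite mxdotE; apply: sumr_ge0 => i _; apply: sumr_ge0 => j _.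
by rewrite -expr2 sqr_ge0.
Qed.

Lemma mxdot_delta (R : realType) (a b : nat) (X : 'M[R]_(a, b)) i j :
  mxdot X (delta_mx i j) = X i j.
Proof.
rewrite mxdotE (bigD1 i) //= (bigD1 j) //= !mxE !eqxx mulr1 !big1 ?addr0 //.
- move=> i' /negPf ii'; apply: big1 => j' _.
  by rewrite mxE ii' mulr0.
- by move=> j' /negPf jj'; rewrite mxE jj' andbF mulr0.
Qed.

Lemma mxdotBl (R : realType) (a b : nat) (X Y Z : 'M[R]_(a, b)) :
  mxdot (X - Y) Z = mxdot X Z - mxdot Y Z.
Proof. by rewrite /mxdot !linearB /= mulmxBl linearB. Qed.

Lemma mxdotZl (R : realType) (a b : nat) (c : R) (X Y : 'M[R]_(a, b)) :
  mxdot (c *: X) Y = c * mxdot X Y.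
Proof. by rewrite /mxdot linearZ /= -scalemxAl linearZ. Qed.

(* The gradient of the loss through the adjoint [Bt] of [B]. *)
Lemma grad_loss (R : realType) (n1 n2 m k : nat)
    (B : {linear 'M[R]_(m, n2) -> 'M[R]_(n1, n2)})
    (Bt : 'M[R]_(n1, n2) -> 'M[R]_(m, n2))
    (adjB : forall U V, mxdot (B U) V = mxdot U (Bt V))
    (Theta : 'M[R]_(m, k)) (psi : 'M[R]_(k, n2)) (Q : 'M[R]_(m, k)) :
  grad (loss B Theta psi) Q = - (Bt (B ((Theta - Q) *m psi)) *m psi^T).
Proof.
apply/matrixP => i j; rewrite 2!mxE.
set E := B ((Theta - Q) *m psi); set v : 'M[R]_(m, k) := delta_mx i j.
set D := B (v *m psi).
have lossE h : loss B Theta psi (h *: v + Q) - loss B Theta psi Q =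
    h * (h / 2 * mxdot D D - mxdot D E).
  rewrite /loss /frob !sqr_sqrtr ?mxdot_ge0 //.
  have -> : B ((Theta - (h *: v + Q)) *m psi) = E - h *: D.
    rewrite /E /D -linearZ -linearB; congr (B _).
    by rewrite scalemxAl -mulmxBl opprD addrCA [- _ + _]addrC.
  rewrite -/E mxdotBl mxdotZl 2!(mxdotC _ (E - _)) !mxdotBl !mxdotZl.
  by rewrite (mxdotC E D); field.
have -> : (Bt E *m psi^T) i j = mxdot D E.
  rewrite -mxdot_delta mxdotC adjB /mxdot trmx_mul -mulmxA.
  by rewrite [RHS]mxtrace_mulC mulmxA.
have lim0 : (fun h : R => h / 2 * mxdot D D - mxdot D E) @ 0^' -->
    0 / 2 * mxdot D D - mxdot D E.
  apply: cvg_within_filter; apply: (@cvgB R R R); last exact: cvg_cst.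
  by apply: cvgMr_tmp; apply: cvgMr_tmp; exact: cvg_id.
rewrite !mul0r sub0r in lim0.
rewrite /derive; apply: cvg_lim; first exact: norm_hausdorff.
apply: cvg_trans lim0; apply: near_eq_cvg; near=> h.
have h0 : h != 0 by near: h; exact: nbhs_dnbhs_neq.
by rewrite /= lossE /GRing.scale /= mulKf.
Unshelve. all: by end_near.
Qed.

(* Main.v *)
Require Import Defs.
From HB Require Import structures.
From mathcomp Require Import all_boot all_order all_algebra.
From mathcomp Require Import all_classical all_reals all_analysis.
From mathcomp Require Import ring lra.

Set Implicit Arguments.
Unset Strict Implicit.
Unset Printing Implicit Defensive.

Import Order.TTheory GRing.Theory Num.Theory.
Import numFieldNormedType.Exports.

Local Open Scope classical_set_scope.
Local Open Scope ring_scope.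

(** The closed loop enters only through the gradient identity
    <grad J_t(Q), Theta - Q> = - 2 J_t(Q), which holds because J_t(Q) is a
    quadratic form in Theta - Q ([mxdot_grad_loss]).  What remains is a
    mirror descent estimate with the mirror map f = (c/2) ||.||_p^2, where
    c = d^(2 - 2/p) / (p - 1).

    Its conjugate is f* = (1/(2c)) ||.||_q^2 by Hoelder's inequality
    ([fenchel_mirrorE]), and grad f inverts grad f* ([grad_mirrorK]), so the
    recursion is plain gradient descent z_(t+1) = z_t - eta_(t+1) g_t for the
    dual variable z_t = grad f(hTheta_t), with g_t = grad J_t(hTheta_t) and
    hTheta_t = grad f*(z_t).  The constant c is chosen to make f* 1-smooth for
    the max norm:
        f*(Z + G) <= f*(Z) + <grad f*(Z), G> + |G|^2 / 2
    ([fenchel_mirror_smooth]).  This rests on the 2-smoothness of ||.||_q^2 for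
    q > 2 with constant q - 1 ([sqnorm_smooth]), on ||G||_q^2 <= d^(2/q) |G|^2
    and on (p - 1)(q - 1) = 1.

    Consider the potential V_t = f*(z_t) - <Theta, z_t>.  It starts at 0, is
    at least - f(Theta) by the Fenchel-Young inequality, and with
    N_t = eps_(t+1) + |g_t|^2 the step size eta_(t+1) = 2 J_t / N_t gives
        V_(t+1) <= V_t - 2 eta_(t+1) J_t + eta_(t+1)^2 N_t / 2
                 = V_t - 2 J_t^2 / N_t
    ([potential_decrease]).  Summing, the total of J_t^2 / N_t is at most
    f(Theta) / 2, and Cauchy-Schwarz bounds the regret by
    sqrt (f(Theta) / 2 * \sum_t N_t) ([mirror_regret]).  Finally, for
    p = 1 + 1 / ln d one has d^(2 - 2/p) <= e^2 and, by sparsity,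
    ||Theta||_p <= s^(1/p) |Theta|, which bounds f(Theta) / 2 by ln d times
    the square of (e/2) s^(1/p) |Theta| ([mirror_sparse_le]). *)

(** * Signed powers and a second-order Taylor bound *)

Section ScalarCalculus.
Variable R : realType.
Implicit Types (a r t : R) (F G : R -> R).

(** The map a |-> sign(a) |a|^r; up to constants, signed and unsigned powers
    differentiate into each other. *)
Definition spow r a : R := Num.sg a * `|a| `^ r.

Lemma spow0 r : spow r 0 = 0.
Proof. by rewrite /spow sgr0 mul0r. Qed.

Lemma spow_gt0 r a : 0 < a -> spow r a = a `^ r.
Proof. by move=> a0; rewrite /spow gtr0_sg // gtr0_norm // mul1r. Qed.

Lemma spowN r a : spow r (- a) = - spow r a.
Proof. by rewrite /spow sgrN normrN mulNr. Qed.

Lemma normr_spow r a : r != 0 -> `|spow r a| = `|a| `^ r.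
Proof.
move=> r0; rewrite /spow normrM normr_sg; have [->|a0] := eqVneq a 0.
  by rewrite mul0r normr0 powR0.
by rewrite mul1r ger0_norm ?powR_ge0.
Qed.

Lemma spow_mulr r a : 0 < r -> spow (r - 1) a * a = `|a| `^ r.
Proof.
by move=> r0; rewrite /spow mulrAC -normrEsg mulr_powRB1.
Qed.

Lemma spowK r r' : r * r' = 1 -> cancel (spow r) (spow r').
Proof.
move=> rr' a.
have r0 : r != 0.
  apply/eqP => r0; move: rr'.
  by rewrite r0 mul0r => /esym/eqP; rewrite oner_eq0.
rewrite {1}/spow normr_spow // -powRrM rr' powRr1 // {1}/spow sgrM sgr_id.
have [->|a0] := eqVneq a 0; first by rewrite normr0 mulr0.
by rewrite (gtr0_sg (powR_gt0 _ _)) ?normr_gt0 // mulr1 -numEsg.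
Qed.

Lemma spowM r c a : 0 < c -> spow r (c * a) = c `^ r * spow r a.
Proof.
move=> c0; rewrite /spow sgrM gtr0_sg // mul1r normrM powRM ?normr_ge0 //.
by rewrite gtr0_norm // mulrCA.
Qed.

(** Settles the derivatives of powers at 0, where [`|a| `^ r] is not locally a
    composite of smooth functions. *)
Lemma is_derive_small r F : 1 < r -> (forall h, `|F h| <= `|h| `^ r) ->
  is_derive (0 : R) 1 F 0.
Proof.
move=> r1 Fle.
have F0 : F 0 = 0.
  apply/eqP; rewrite -normr_le0; apply: le_trans (Fle 0) _.
  by rewrite normr0 powR0 // gt_eqF // (lt_trans ltr01).
have cvgF :
    (fun h => h^-1 *: ((F \o shift 0) (h *: (1 : R)) - F 0)) @ 0^' --> (0 : R).
  apply/cvgr0Pnorm_lt => e e0; near=> h.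
  have h0 : h != 0 by near: h; exact: nbhs_dnbhs_neq.
  rewrite /= F0 subr0 addr0 /GRing.scale /= mulr1 normrM normfV.
  apply: (@le_lt_trans _ _ (`|h| `^ (r - 1))).
    rewrite ler_pdivrMl ?normr_gt0 // mulr_powRB1 //.
    exact: lt_trans r1.
  have -> : e = (e `^ (r - 1)^-1) `^ (r - 1).
    by rewrite -powRrM mulVf ?powRr1 // ?ltW // gt_eqF // subr_gt0.
  apply: gt0_ltr_powR; rewrite ?subr_gt0 ?nnegrE ?powR_ge0 //.
  near: h; apply: dnbhs0_lt; exact: powR_gt0.
apply: DeriveDef; first by apply/cvg_ex; exists 0.
by apply: cvg_lim cvgF; exact: norm_hausdorff.
Unshelve. all: by end_near. Qed.

Lemma is_derive_normpow r a : 1 < r ->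
  is_derive a 1 (fun b : R => `|b| `^ r) (r * spow (r - 1) a).
Proof.
move=> r1; case: (ltgtP a 0) => [a0|a0|->].
- apply: (@near_eq_is_derive _ _ _ ((fun b => b `^ r) \o -%R)).
    by near=> b; rewrite /= ltr0_norm //; near: b; exact: lt_nbhsl.
  have Na0 : 0 < - a by rewrite oppr_gt0.
  have dN := @is_derive1_powR R r _ Na0.
  apply: is_derive_eq (is_derive1_comp dN (is_deriveNid _ _)) _.
  by rewrite -[in RHS](opprK a) spowN spow_gt0 // mulrN1 mulrN.
- apply: (@near_eq_is_derive _ _ _ (fun b => b `^ r)).
    by near=> b; rewrite /= gtr0_norm //; near: b; exact: lt_nbhsr.
  by rewrite spow_gt0 //; exact: is_derive1_powR.
- rewrite spow0 mulr0; apply: (is_derive_small r1) => h.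
  by rewrite ger0_norm ?powR_ge0.
Unshelve. all: by end_near. Qed.

Lemma is_derive_spow r a : 1 < r ->
  is_derive a 1 (spow r) (r * `|a| `^ (r - 1)).
Proof.
move=> r1; case: (ltgtP a 0) => [a0|a0|->].
- apply: (@near_eq_is_derive _ _ _ (fun b => - `|b| `^ r)).
    by near=> b; rewrite /spow ltr0_sg ?mulN1r //; near: b; exact: lt_nbhsl.
  have dN := @is_derive_normpow r a r1.
  apply: is_derive_eq (is_deriveN dN) _.
  by rewrite /spow ltr0_sg // mulN1r mulrN opprK.
- apply: (@near_eq_is_derive _ _ _ (fun b => `|b| `^ r)).
    by near=> b; rewrite /spow gtr0_sg ?mul1r //; near: b; exact: lt_nbhsr.
  have dN := @is_derive_normpow r a r1.
  by apply: is_derive_eq dN _; rewrite /spow gtr0_sg ?mul1r.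
- have r10 : r - 1 != 0 by rewrite subr_eq0 gt_eqF.
  rewrite normr0 powR0 // mulr0; apply: (is_derive_small r1) => h.
  by rewrite normr_spow // gt_eqF // (lt_trans ltr01).
Unshelve. all: by end_near. Qed.

Lemma is_derive_fsum (I : finType) (h : I -> R -> R) (dh : I -> R) t :
  (forall i, is_derive t 1 (h i) (dh i)) ->
  is_derive t 1 (fun u => \sum_i h i u) (\sum_i dh i).
Proof.
move=> dhE; have -> : (fun u => \sum_i h i u) = \sum_i h i.
  by apply/funext => u; rewrite fct_sumE.
by elim/big_ind2 : _ => // [|*]; [exact: is_derive_cst|exact: is_deriveD].
Qed.

Lemma is_derive_line x v t : is_derive t 1 (fun u : R => x + u * v) v.
Proof.
have -> : (fun u : R => x + u * v) = cst x + v *: (id : R -> R).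
  by apply/funext => u; rewrite fctE /= fctE /GRing.scale /= mulrC.
have dZ := is_deriveZ v (is_derive_id t (1 : R)).
apply: is_derive_eq (is_deriveD (is_derive_cst x t 1) dZ) _.
by rewrite add0r /GRing.scale /= mulr1.
Qed.

Lemma is_derive_on_line F (dF x v t : R) : is_derive (x + t * v) 1 F dF ->
  is_derive t 1 (fun u => F (x + u * v)) (dF * v).
Proof. by move=> dFP; apply: is_derive1_comp; exact: is_derive_line. Qed.

(** Two applications of the mean value theorem: first to F' - M u, which is
    nonincreasing, then to F minus its candidate quadratic majorant. *)
Lemma taylor2_le F F' F'' M : (forall t, is_derive t 1 F (F' t)) ->
  (forall t, is_derive t 1 F' (F'' t)) -> (forall t, F'' t <= M) ->
  F 1 <= F 0 + F' 0 + M / 2.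
Proof.
move=> dF dF' F''M.
have decr (G G' : R -> R) (t : R) : (forall u : R, is_derive u 1 G (G' u)) ->
    0 <= t -> (forall u, 0 <= u -> G' u <= 0) -> G t <= G 0.
  move=> dG t0 G'0.
  have contG : {within `[0, t], continuous G}.
    apply/continuous_subspaceT => u.
    by apply/differentiable_continuous/derivable1_diffP; case: (dG u).
  have [c /itvP cE] := MVT_segment t0 (fun u _ => dG u) contG.
  move=> /eqP; rewrite subr0 subr_eq => /eqP ->.
  by rewrite gerDr mulr_le0_ge0 ?G'0 ?cE.
have dquad c t : is_derive t 1 (fun u : R => c * u) c.
  have -> : (fun u : R => c * u) = (fun u => 0 + u * c).
    by apply/funext => u; rewrite add0r mulrC.
  exact: is_derive_line.
have F'le t : 0 <= t -> F' t - F' 0 - M * t <= 0.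
  move=> t0; have := decr _ _ t (fun u => is_deriveB (dF' u) (dquad M u)) t0.
  move=> dle; have {dle} : F' t - M * t <= F' 0 - M * 0.
    by apply: dle => u _; rewrite subr_le0.
  by rewrite mulr0 subr0 addrAC subr_le0.
have dG (u : R) : is_derive u 1 (fun u => F u - (F' 0 * u + M / 2 * u ^+ 2))
    (F' u - F' 0 - M * u).
  have dsqr : is_derive u 1 (fun w : R => M / 2 * w ^+ 2) (M * u).
    have -> : (fun w : R => M / 2 * w ^+ 2) = (M / 2) *: (id * id : R -> R).
      by apply/funext.
    apply: is_derive_eq.
    by rewrite /GRing.scale /=; field.
  apply: is_derive_eq (is_deriveB (dF u) (is_deriveD (dquad (F' 0) u) dsqr)) _.
  by rewrite opprD addrA.
have := decr _ _ 1 dG ler01 F'le.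
by rewrite !mulr1 mulr0 expr1n expr0n mulr0 addr0 subr0 mulr1 lerBlDr addrA.
Qed.

End ScalarCalculus.

(** * Sums of powers, Hoelder duality *)

Section PowerSums.
Variables (R : realType) (I : finType).
Implicit Types (x y z v : I -> R) (p q r c t : R).

Definition psum r x : R := \sum_i `|x i| `^ r.
Definition sqnorm r x : R := psum r x `^ (2 / r).
(** Half the gradient of [sqnorm r]; at x = 0 its value is 0 whatever the power
    of the vanishing sum evaluates to, since the signed powers vanish. *)
Definition dualmap r x i : R := psum r x `^ (2 / r - 1) * spow (r - 1) (x i).
Definition line x v t i : R := x i + t * v i.

Lemma psum_ge0 r x : 0 <= psum r x.
Proof. by apply: sumr_ge0 => i _; exact: powR_ge0. Qed.

Lemma sqnorm_ge0 r x : 0 <= sqnorm r x.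
Proof. exact: powR_ge0. Qed.

Lemma psum_eq0 r x : psum r x = 0 -> forall i, x i = 0.
Proof.
move=> /psumr_eq0P x0 i; apply/eqP; rewrite -normr_eq0.
by apply/eqP/(@powR_eq0_eq0 _ _ r)/x0 => // j _; exact: powR_ge0.
Qed.

Lemma psumZ r c x : psum r (fun i => c * x i) = `|c| `^ r * psum r x.
Proof. by rewrite mulr_sumr; apply: eq_bigr => i _; rewrite normrM powRM. Qed.

Lemma sqnormZ r c x : r != 0 ->
  sqnorm r (fun i => c * x i) = c ^+ 2 * sqnorm r x.
Proof.
move=> r0; rewrite /sqnorm psumZ powRM ?powR_ge0 ?psum_ge0 //.
by rewrite -powRrM [r * _]mulrC divfK // powR_mulrn // real_normK ?num_real.
Qed.

Lemma dualmap_pairing r x : 0 < r -> \sum_i dualmap r x i * x i = sqnorm r x.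
Proof.
move=> r0; transitivity (psum r x `^ (2 / r - 1) * psum r x).
  by rewrite mulr_sumr; apply: eq_bigr => i _; rewrite -mulrA spow_mulr.
by rewrite mulrC mulr_powRB1 ?psum_ge0 // divr_gt0.
Qed.

(** Young's inequality, summed over the entries of x and y after dividing each
    by its norm. *)
Lemma hoelder_sum p q x y : 0 < p -> 0 < q -> p^-1 + q^-1 = 1 ->
  \sum_i x i * y i <= psum p x `^ p^-1 * psum q y `^ q^-1.
Proof.
move=> p0 q0 pq.
have [/psum_eq0 x0|px0] := eqVneq (psum p x) 0.
  by rewrite big1 ?mulr_ge0 ?powR_ge0 // => i _; rewrite x0 mul0r.
have [/psum_eq0 y0|py0] := eqVneq (psum q y) 0.
  by rewrite big1 ?mulr_ge0 ?powR_ge0 // => i _; rewrite y0 mulr0.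
have norm1 r w : 0 < r -> psum r w != 0 ->
    \sum_i (`|w i| * psum r w `^ (- r^-1)) `^ r = 1.
  move=> r0 w0; rewrite -[RHS](divff w0) [in RHS]mulr_suml.
  apply: eq_bigr => i _.
  rewrite powRM ?powR_ge0 // -powRrM mulNr mulVf ?gt_eqF //.
  by rewrite powR_inv1 ?psum_ge0.
have ge0 r (w : I -> R) i : 0 <= `|w i| * psum r w `^ (- r^-1).
  by rewrite mulr_ge0 ?powR_ge0.
rewrite -[leRHS]mul1r -ler_pdivrMr; last first.
  by rewrite mulr_gt0 // powR_gt0 // lt_neqAle eq_sym psum_ge0 andbT.
have <- : \sum_i ((`|x i| * psum p x `^ (- p^-1)) `^ p / p +
    (`|y i| * psum q y `^ (- q^-1)) `^ q / q) = 1.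
  rewrite big_split /=.
  set u := bigop _ _ _.
  have -> : u = p^-1 by rewrite /u -mulr_suml norm1 // mul1r.
  by rewrite -mulr_suml norm1 // mul1r.
rewrite mulr_suml; apply: ler_sum => i _.
apply: le_trans (conjugate_powR (ge0 p x i) (ge0 q y i) p0 q0 pq).
rewrite mulrACA !powRN -invfM.
by rewrite ler_wpM2r ?invr_ge0 ?mulr_ge0 ?powR_ge0 // -normrM ler_norm.
Qed.

(** Hoelder's inequality followed by completing the square: with a and b the
    two norms, the gap is at least (c a - b)^2 / (2 c). *)
Lemma fenchel_young p q c x y : 0 < p -> 0 < q -> p^-1 + q^-1 = 1 -> 0 < c ->
  \sum_i x i * y i <= c / 2 * sqnorm p x + (2 * c)^-1 * sqnorm q y.
Proof.
move=> p0 q0 pq c0; apply: le_trans (hoelder_sum x y p0 q0 pq) _.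
have sqE r w : sqnorm r w = (psum r w `^ r^-1) ^+ 2.
  by rewrite -powR_mulrn ?powR_ge0 // -powRrM mulrC.
rewrite !sqE; set a := _ `^ _; set b := _ `^ _; rewrite -subr_ge0.
have -> : c / 2 * a ^+ 2 + (2 * c)^-1 * b ^+ 2 - a * b =
    (2 * c)^-1 * (c * a - b) ^+ 2 by field; rewrite gt_eqF.
by rewrite mulr_ge0 ?sqr_ge0 // invr_ge0 mulr_ge0 // ltW.
Qed.

Lemma conjugate_add p q : 0 < p -> 0 < q -> p^-1 + q^-1 = 1 -> p * q = p + q.
Proof.
move=> p0 q0 pq; have : p * q * (p^-1 + q^-1) = p * q by rewrite pq mulr1.
by move=> <-; field; rewrite !gt_eqF.
Qed.

Lemma conjugate_mulB1 p q : 0 < p -> 0 < q -> p^-1 + q^-1 = 1 ->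
  (q - 1) * (p - 1) = 1.
Proof.
move=> p0 q0 pq.
by rewrite mulrBl !mulrBr [q * p]mulrC (conjugate_add p0 q0 pq); ring.
Qed.

Section Conjugate.
Variables p q : R.
Hypotheses (p0 : 0 < p) (q0 : 0 < q) (pq : p^-1 + q^-1 = 1).

Let pqD : p * q = p + q. Proof. exact: conjugate_add. Qed.
Let pq1 : (q - 1) * (p - 1) = 1. Proof. exact: conjugate_mulB1. Qed.
Let q1 : 0 < q - 1.
Proof.
have : 0 < p * (q - 1) by rewrite mulrBr pqD mulr1 addrAC subrr add0r.
by rewrite pmulr_rgt0.
Qed.

(** The conjugacy relation gives (q - 1) p = q, so that the p-th powers of the
    entries |z|^(q - 1) are the q-th powers of the entries of z. *)
Lemma psum_dualmap z : psum p (dualmap q z) = psum q z `^ (p / q).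
Proof.
have pq0 : p / q != 0 by rewrite mulf_neq0 ?invr_eq0 // gt_eqF.
have [S0|S0] := eqVneq (psum q z) 0.
  rewrite S0 powR0 //; apply: big1 => i _.
  by rewrite /dualmap (psum_eq0 S0) spow0 mulr0 normr0 powR0 // gt_eqF.
transitivity (psum q z `^ ((2 / q - 1) * p) * psum q z); last first.
  rewrite -[X in _ * X](powRr1 (psum_ge0 _ _)) -powRD ?S0 ?implybT //.
  congr (_ `^ _); apply/eqP; rewrite -subr_eq0; apply/eqP.
  have -> : (2 / q - 1) * p + 1 - p / q = (p + q - p * q) / q.
    by field; rewrite gt_eqF.
  by rewrite pqD subrr mul0r.
rewrite mulr_sumr; apply: eq_bigr => i _.
rewrite /dualmap normrM powRM // ger0_norm ?powR_ge0 // normr_spow ?gt_eqF //.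
rewrite -!powRrM; congr (_ * _ `^ _).
by rewrite mulrBl mul1r mulrC pqD addrAC subrr add0r.
Qed.

Lemma sqnorm_dualmap z : sqnorm p (dualmap q z) = sqnorm q z.
Proof.
rewrite /sqnorm psum_dualmap -powRrM; congr (_ `^ _).
by field; rewrite !gt_eqF.
Qed.

Lemma dualmapK : cancel (dualmap q) (dualmap p).
Proof.
move=> z; apply/funext => i.
have [S0|S0] := eqVneq (psum q z) 0.
  have z0 := psum_eq0 S0 i.
  have d0 : dualmap q z i = 0 by rewrite /dualmap z0 spow0 mulr0.
  by rewrite {1}/dualmap d0 spow0 mulr0.
have Sgt0 : 0 < psum q z by rewrite lt_neqAle eq_sym S0 psum_ge0.
rewrite {1}/dualmap psum_dualmap {1}/dualmap spowM ?powR_gt0 // spowK //.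
rewrite mulrA -!powRrM -powRD ?S0 ?implybT //.
have -> : p / q * (2 / p - 1) + (2 / q - 1) * (p - 1) = (p + q - p * q) / q.
  by field; rewrite !gt_eqF.
by rewrite pqD subrr mul0r powRr0 mul1r.
Qed.

(** Equality in the Fenchel-Young inequality: the point where the supremum
    defining the conjugate of (c/2) ||.||_p^2 is attained. *)
Lemma fenchel_young_dualmap c z : 0 < c ->
  let x i := c^-1 * dualmap q z i in
  \sum_i x i * z i = c / 2 * sqnorm p x + (2 * c)^-1 * sqnorm q z.
Proof.
move=> c0 x; rewrite sqnormZ ?gt_eqF // sqnorm_dualmap.
transitivity (c^-1 * sqnorm q z).
  rewrite -dualmap_pairing // mulr_sumr; apply: eq_bigr => i _.
  by rewrite mulrA.
by field; rewrite gt_eqF.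
Qed.

End Conjugate.

Lemma dualmapZ r c x i : 0 < r -> 0 < c ->
  dualmap r (fun i => c * x i) i = c * dualmap r x i.
Proof.
move=> r0 c0; rewrite /dualmap psumZ powRM ?powR_ge0 ?psum_ge0 // spowM //.
rewrite mulrACA; congr (_ * _).
rewrite gtr0_norm // -powRrM -powRD ?(gt_eqF c0) ?implybT //.
rewrite -[RHS](powRr1 (ltW c0)); congr (_ `^ _).
by field; rewrite gt_eqF.
Qed.

(** * Smoothness of squared norms *)

Lemma is_derive_psum_line r x v t : 1 < r ->
  is_derive t 1 (fun u => psum r (line x v u))
    (r * \sum_i spow (r - 1) (line x v t i) * v i).
Proof.
move=> r1; rewrite mulr_sumr; apply: is_derive_fsum => i; rewrite mulrA.
exact: (is_derive_on_line (is_derive_normpow _ r1)).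
Qed.

Lemma is_derive_psum_pow_line r b x v t : 1 < r -> 0 < psum r (line x v t) ->
  is_derive t 1 (fun u => psum r (line x v u) `^ b)
    (b * psum r (line x v t) `^ (b - 1) *
      (r * \sum_i spow (r - 1) (line x v t i) * v i)).
Proof.
move=> r1 S0.
exact: is_derive1_comp (is_derive1_powR b S0) (is_derive_psum_line x v t r1).
Qed.

(** A line through the origin: the other points are multiples of its direction.
    This covers the parameters where the power [2 / r] of the sum is not known
    to be differentiable by composition. *)
Lemma sqnorm_line_zero r x v t u : r != 0 -> psum r (line x v t) = 0 ->
  sqnorm r (line x v u) = (u - t) ^+ 2 * sqnorm r v.
Proof.
move=> r0 /psum_eq0 xv0; rewrite -(sqnormZ _ _ r0).
congr sqnorm; apply/funext => i.
have := xv0 i; rewrite /line => /eqP; rewrite addr_eq0 => /eqP ->.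
by rewrite mulrBl addrC.
Qed.

Lemma dualmap_sum r x v :
  \sum_i dualmap r x i * v i =
  psum r x `^ (2 / r - 1) * \sum_i spow (r - 1) (x i) * v i.
Proof. by rewrite mulr_sumr; apply: eq_bigr => i _; rewrite mulrA. Qed.

Lemma is_derive_sqnorm_line r x v t : 1 < r ->
  is_derive t 1 (fun u => sqnorm r (line x v u))
    (2 * \sum_i dualmap r (line x v t) i * v i).
Proof.
move=> r1; have r0 : 0 < r by exact: lt_trans r1.
have [S0|S0] := eqVneq (psum r (line x v t)) 0.
  have -> : (fun u => sqnorm r (line x v u)) =
      sqnorm r v *: ((id - cst t) * (id - cst t) : R -> R).
    apply/funext => u; rewrite (sqnorm_line_zero u _ S0) ?gt_eqF //.
    by rewrite mulrC expr2.
  apply: is_derive_eq.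
  rewrite big1 => [|i _]; last first.
    by rewrite /dualmap (psum_eq0 S0) spow0 mulr0 mul0r.
  by rewrite /GRing.scale /= !fctE subrr !mul0r addr0 !mulr0.
have Sgt0 : 0 < psum r (line x v t) by rewrite lt_neqAle eq_sym S0 psum_ge0.
apply: is_derive_eq (is_derive_psum_pow_line (2 / r) r1 Sgt0) _.
rewrite dualmap_sum; set G := bigop _ _ _; set P := _ `^ _.
by field; rewrite gt_eqF.
Qed.

(** Second-order Taylor along the segment from z to z + v.  The second
    derivative of the squared norm has a term proportional to 2/q - 1, negative
    because q > 2, and a term that Hoelder's inequality with exponents
    q / (q - 2) and q / 2 bounds by 2 (q - 1) ||v||_q^2.  When the line through
    z and z + v meets the origin, where the norm may fail to be twice
    differentiable, z is a multiple of v and the inequality is elementary. *)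
Lemma sqnorm_smooth q z v : 2 < q ->
  sqnorm q (fun i => z i + v i) <=
    sqnorm q z + 2 * \sum_i dualmap q z i * v i + (q - 1) * sqnorm q v.
Proof.
move=> q2; have q0 : 0 < q by exact: lt_trans q2.
have q1 : 1 < q by apply: lt_trans q2; rewrite ltr1n.
have l0 : line z v 0 = z by apply/funext => i; rewrite /line mul0r addr0.
have l1 : line z v 1 = fun i => z i + v i.
  by apply/funext => i; rewrite /line mul1r.
have [[t /= S0]|S0] := pselect (exists t, psum q (line z v t) = 0).
  have sqE := sqnorm_line_zero _ _ S0; rewrite -l1 sqE ?gt_eqF //.
  rewrite -{1}l0 sqE ?gt_eqF //.
  have zE i : z i = - t * v i.
    by apply/eqP; rewrite mulNr -addr_eq0; apply/eqP/(psum_eq0 S0).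
  have dz : \sum_i dualmap q z i * v i = - t * sqnorm q v.
    have [t0|t0] := eqVneq t 0.
      rewrite t0 oppr0 mul0r; apply: big1 => i _.
      by rewrite /dualmap zE t0 oppr0 mul0r spow0 mulr0 mul0r.
    apply: (@mulfI _ (- t)); first by rewrite oppr_eq0.
    rewrite mulrA mulrNN -expr2 -[t ^+ 2]sqrrN -[- t]add0r -sqE ?gt_eqF // l0.
    rewrite -dualmap_pairing // sub0r mulr_sumr; apply: eq_bigr => i _.
    by rewrite mulrCA -zE.
  rewrite dz -subr_ge0; set N := sqnorm q v.
  have -> : (0 - t) ^+ 2 * N + 2 * (- t * N) + (q - 1) * N - (1 - t) ^+ 2 * N =
    (q - 2) * N by ring.
  by rewrite mulr_ge0 ?sqnorm_ge0 // subr_ge0 ltW.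
have Sgt0 t : 0 < psum q (line z v t).
  rewrite lt_neqAle eq_sym psum_ge0 andbT.
  by apply/eqP => S0t; apply: S0; exists t.
pose G t := \sum_i spow (q - 1) (line z v t i) * v i.
pose H t := \sum_i `|line z v t i| `^ (q - 2) * v i ^+ 2.
pose S t := psum q (line z v t).
have dG (t : R) : is_derive t 1 G ((q - 1) * H t).
  rewrite mulr_sumr; apply: is_derive_fsum => i.
  have -> : (fun u => spow (q - 1) (line z v u i) * v i) =
      v i *: (fun u => spow (q - 1) (line z v u i)).
    by apply/funext => u; rewrite mulrC.
  have q11 : 1 < q - 1 by rewrite ltrBrDr.
  have dspow := is_derive_on_line (is_derive_spow (line z v t i) q11).
  apply: is_derive_eq (is_deriveZ (v i) dspow) _.
  have -> : q - 1 - 1 = q - 2 by ring.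
  by rewrite /GRing.scale /=; ring.
have HS t : H t <= S t `^ (1 - 2 / q) * sqnorm q v.
  have q20 : 0 < q - 2 by rewrite subr_gt0.
  have r0 : 0 < q / (q - 2) by rewrite divr_gt0.
  have r0' : 0 < q / 2 by rewrite divr_gt0.
  have rr : (q / (q - 2))^-1 + (q / 2)^-1 = 1 by field; rewrite !gt_eqF.
  have := hoelder_sum (fun i => `|line z v t i| `^ (q - 2))
    (fun i => v i ^+ 2) r0 r0' rr.
  have -> : psum (q / (q - 2)) (fun i => `|line z v t i| `^ (q - 2)) = S t.
    rewrite /S /psum; apply: eq_bigr => i _.
    rewrite ger0_norm ?powR_ge0 // -powRrM.
    by congr (_ `^ _); field; rewrite gt_eqF.
  have -> : psum (q / 2) (fun i => v i ^+ 2) = psum q v.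
    rewrite /psum; apply: eq_bigr => i _; rewrite normrX -powR_mulrn // -powRrM.
    by congr (_ `^ _); field.
  rewrite !invf_div.
  by have -> : (q - 2) / q = 1 - 2 / q by field; rewrite gt_eqF.
pose F' t := 2 * (S t `^ (2 / q - 1) * G t).
pose F'' t := 2 * (S t `^ (2 / q - 1) * ((q - 1) * H t) +
   G t * ((2 / q - 1) * S t `^ (2 / q - 1 - 1) * (q * G t))).
have F'E t : F' t = 2 * \sum_i dualmap q (line z v t) i * v i.
  by rewrite dualmap_sum.
have := @taylor2_le R (fun t => sqnorm q (line z v t)) F' F''
  (2 * ((q - 1) * sqnorm q v)).
rewrite l0 l1 F'E l0 => taylor.
rewrite -[X in _ + X](mulfK (_ : 2 != 0)) ?pnatr_eq0 //.
rewrite [X in _ + X / 2]mulrC; apply: taylor => t.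
- by rewrite F'E; exact: is_derive_sqnorm_line.
- have dS : is_derive t 1 (fun u => S u `^ (2 / q - 1))
    ((2 / q - 1) * S t `^ (2 / q - 1 - 1) * (q * G t)).
    exact: is_derive_psum_pow_line.
  exact: (is_deriveZ 2 (is_deriveM dS (dG t))).
- rewrite /F'' ler_pM2l //; set P := S t `^ (2 / q - 1 - 1).
  have -> : G t * ((2 / q - 1) * P * (q * G t)) = - ((q - 2) * P * G t ^+ 2).
    by field; rewrite gt_eqF.
  apply: le_trans (_ : S t `^ (2 / q - 1) * ((q - 1) * H t) <= _).
    rewrite gerDl oppr_le0 mulr_ge0 ?sqr_ge0 // mulr_ge0 ?powR_ge0 //.
    by rewrite subr_ge0 ltW.
  rewrite mulrCA ler_pM2l ?subr_gt0 //.
  apply: le_trans (ler_wpM2l (powR_ge0 _ _) (HS t)) _.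
  rewrite mulrA -powRD ?(gt_eqF (Sgt0 t)) ?implybT //.
  have -> : 2 / q - 1 + (1 - 2 / q) = 0 by ring.
  by rewrite powRr0 mul1r.
Qed.
End PowerSums.

(** * The mirror map and its conjugate *)

Section MatrixMirror.
Variables (R : realType) (m k : nat).
Implicit Types (Q Z G Theta : 'M[R]_(m, k)) (a p q r : R).

Definition entries Q (ij : 'I_m * 'I_k) : R := Q ij.1 ij.2.

Lemma mxdot_entries Q Z : mxdot Q Z = \sum_ij entries Q ij * entries Z ij.
Proof. by rewrite mxdotE pair_bigA. Qed.

Lemma mxdotDr (X Y W : 'M[R]_(m, k)) : mxdot X (Y + W) = mxdot X Y + mxdot X W.
Proof. by rewrite /mxdot mulmxDr linearD. Qed.

Lemma mxdotZr a (X Y : 'M[R]_(m, k)) : mxdot X (a *: Y) = a * mxdot X Y.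
Proof. by rewrite mxdotC mxdotZl mxdotC. Qed.

Lemma lp_norm_sqr r Q : lp_norm r Q ^+ 2 = sqnorm r (entries Q).
Proof.
rewrite /lp_norm pair_bigA -powR_mulrn ?powR_ge0 // -powRrM.
by rewrite [r^-1 * _]mulrC.
Qed.

Lemma grad_sqnorm a r (F : 'M[R]_(m, k) -> R) Q :
  1 < r -> (forall Y, F Y = a / 2 * sqnorm r (entries Y)) ->
  entries (grad F Q) = fun ij => a * dualmap r (entries Q) ij.
Proof.
move=> r1 FE; apply/funext => -[i j]; rewrite /entries /= mxE.
pose D : 'M[R]_(m, k) := delta_mx i j.
have -> : 'D_D (F : 'M[R]_(m, k) -> R^o) Q =
    'D_1 (fun h : R => F (h *: D + Q)) (0 : R).
  rewrite /derive; set g1 := fun h => h^-1 *: _; set g2 := fun h => h^-1 *: _.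
  suff -> : g1 = g2 by [].
  by apply/funext => h; rewrite /g1 /g2 /= scale0r add0r addr0 [_%:A]mulr1.
have -> : (fun h : R => F (h *: D + Q)) =
    (a / 2) *: (fun h : R => sqnorm r (line (entries Q) (entries D) h)).
  apply/funext => h; rewrite FE; congr (_ * sqnorm _ _).
  apply/funext => -[i' j'].
  by rewrite /entries /line /= !mxE addrC.
have dsq := is_derive_sqnorm_line (entries Q) (entries D) 0 r1.
have [_ ->] := is_deriveZ (a / 2) dsq.
have -> : line (entries Q) (entries D) 0 = entries Q.
  by apply/funext => ij; rewrite /line mul0r addr0.
have -> : \sum_ij dualmap r (entries Q) ij * entries D ij =
    dualmap r (entries Q) (i, j).
  rewrite (bigD1 (i, j)) //= big1 ?addr0.
    by rewrite /entries mxE /= !eqxx mulr1.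
  by move=> [i' j'] ij'; rewrite /entries mxE /= -xpair_eqE (negPf ij') mulr0.
by rewrite /GRing.scale /= mulrA divfK.
Qed.

Lemma normr_entries_le Q ij : `|entries Q ij| <= `|Q|.
Proof.
rewrite {2}/Num.norm /= mx_normrE.
exact: (le_bigmax _ (fun ij => `|Q ij.1 ij.2|)).
Qed.

Lemma psum_le_support r Q : 0 < r ->
  psum r (entries Q) <= #|[set ij | entries Q ij != 0%R]%SET|%:R * `|Q| `^ r.
Proof.
move=> r0; rewrite /psum (bigID (mem [set ij | entries Q ij != 0%R]%SET)) /=.
rewrite [X in _ + X]big1 ?addr0 => [|ij]; last first.
  by rewrite inE negbK => /eqP ->; rewrite normr0 powR0 // gt_eqF.
rewrite mulr_natl -sumr_const; apply: ler_sum => ij _.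
by apply: ge0_ler_powR; rewrite ?nnegrE ?(ltW r0) ?normr_entries_le.
Qed.

Lemma sqnorm_le_sparse r Q (s : nat) : 0 < r ->
  (#|[set ij | entries Q ij != 0%R]%SET| <= s)%N ->
  sqnorm r (entries Q) <= s%:R `^ (2 / r) * `|Q| ^+ 2.
Proof.
move=> r0 Qs; have -> : `|Q| ^+ 2 = (`|Q| `^ r) `^ (2 / r).
  by rewrite -powRrM [r * _]mulrC divfK ?gt_eqF // powR_mulrn.
rewrite -powRM ?powR_ge0 //; apply: ge0_ler_powR.
- by rewrite divr_ge0 // ltW.
- by rewrite nnegrE psum_ge0.
- by rewrite nnegrE mulr_ge0 ?powR_ge0.
apply: le_trans (psum_le_support _ r0) _.
by rewrite ler_wpM2r ?powR_ge0 // ler_nat.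
Qed.

Section MirrorPair.
Variables p q : R.
Hypotheses (p1 : 1 < p) (q2 : 2 < q) (pq : p^-1 + q^-1 = 1).
Hypothesis d0 : (0 < m * k)%N.

Let p0 : 0 < p. Proof. exact: lt_trans p1. Qed.
Let q0 : 0 < q. Proof. exact: lt_trans q2. Qed.
Let q1 : 1 < q. Proof. by apply: lt_trans q2; rewrite ltr1n. Qed.
Let c : R := (m * k)%:R `^ (2 - 2 / p) / (p - 1).
Let c0 : 0 < c.
Proof. by rewrite divr_gt0 ?subr_gt0 // powR_gt0 // ltr0n. Qed.

Lemma mirrorE Q : mirror p Q = c / 2 * sqnorm p (entries Q).
Proof.
rewrite /mirror lp_norm_sqr /c; congr (_ * _).
by field; rewrite subr_eq0 gt_eqF.
Qed.

Lemma fenchel_young_mirror Q Z :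
  mxdot Q Z <= mirror p Q + (2 * c)^-1 * sqnorm q (entries Z).
Proof. by rewrite mxdot_entries mirrorE; exact: fenchel_young. Qed.

(** [fenchel_young_mirror] bounds the supremum, and the rescaled dual vector Q
    attains the bound. *)
Lemma fenchel_mirrorE Z :
  fenchel (mirror p) Z = (2 * c)^-1 * sqnorm q (entries Z).
Proof.
pose Q : 'M[R]_(m, k) := \matrix_(i, j) (c^-1 * dualmap q (entries Z) (i, j)).
have QE : entries Q = fun ij => c^-1 * dualmap q (entries Z) ij.
  by apply/funext => -[i j]; rewrite /entries mxE.
have ub : ubound [set mxdot Y Z - mirror p Y | Y in [set: 'M[R]_(m, k)]]
    ((2 * c)^-1 * sqnorm q (entries Z)).
  by move=> _ [Y _ <-]; rewrite lerBlDl fenchel_young_mirror.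
apply/eqP; rewrite eq_le ge_sup //=; last by eexists; exists Q.
have -> : (2 * c)^-1 * sqnorm q (entries Z) = mxdot Q Z - mirror p Q.
  rewrite mxdot_entries mirrorE QE (fenchel_young_dualmap p0 q0 pq _ c0).
  by rewrite addrAC subrr add0r.
by apply: ub_le_sup; [eexists; exact: ub|exists Q].
Qed.

Lemma grad_fenchel_mirror Z :
  entries (grad (fenchel (mirror p)) Z) =
  fun ij => c^-1 * dualmap q (entries Z) ij.
Proof.
apply: grad_sqnorm q1 _ => Y; rewrite fenchel_mirrorE; congr (_ * _).
by field; rewrite gt_eqF.
Qed.

Lemma grad_mirrorK Z : grad (mirror p) (grad (fenchel (mirror p)) Z) = Z.
Proof.
apply/matrixP => i j; set Q := grad (fenchel (mirror p)) Z.
transitivity (entries (grad (mirror p) Q) (i, j)); first by [].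
rewrite (grad_sqnorm Q p1 mirrorE) /Q.
rewrite grad_fenchel_mirror dualmapZ ?invr_gt0 // (dualmapK p0 q0 pq).
by rewrite mulrA divff ?gt_eqF // mul1r.
Qed.

Lemma grad_fenchel_mirror0 : grad (fenchel (mirror p)) (0 : 'M[R]_(m, k)) = 0.
Proof.
apply/matrixP => i j; set Q := grad (fenchel (mirror p)) (0 : 'M[R]_(m, k)).
transitivity (entries Q (i, j)); first by [].
rewrite /Q grad_fenchel_mirror /dualmap mxE.
have -> : entries (0 : 'M[R]_(m, k)) (i, j) = 0 by rewrite /entries mxE.
by rewrite spow0 !mulr0.
Qed.

(** The normalisation of the mirror map is made for this: passing from the
    l_q norm to the max norm costs d^(2/q) = d^(2 - 2/p), the smoothness
    constant of the squared l_q norm is q - 1 = 1 / (p - 1), and 1 / (2 c)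
    cancels both up to the factor 1/2. *)
Lemma fenchel_mirror_smooth Z G :
  fenchel (mirror p) (Z + G) <=
    fenchel (mirror p) Z + mxdot (grad (fenchel (mirror p)) Z) G +
    `|G| ^+ 2 / 2.
Proof.
rewrite !fenchel_mirrorE mxdot_entries grad_fenchel_mirror.
have -> : entries (Z + G) = fun ij => entries Z ij + entries G ij.
  by apply/funext => ij; rewrite /entries mxE.
have sm := sqnorm_smooth (entries Z) (entries G) q2.
have cV0 : 0 < (2 * c)^-1 by rewrite invr_gt0 mulr_gt0.
apply: le_trans (ler_wpM2l (ltW cV0) sm) _.
rewrite !mulrDr lerD //; first rewrite lerD //.
  rewrite mulrA; under [leRHS]eq_bigr do rewrite -mulrA.
  rewrite -mulr_sumr; set S := bigop _ _ _.
  by rewrite le_eqVlt; apply/orP; left; apply/eqP; field; rewrite gt_eqF.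
have supp : (#|[set ij | entries G ij != 0%R]%SET| <= m * k)%N.
  by apply: leq_trans (max_card _) _; rewrite card_prod !card_ord.
have q10 : 0 < q - 1 by rewrite subr_gt0.
have sG := sqnorm_le_sparse q0 supp.
rewrite mulrCA.
apply: le_trans (ler_wpM2l (ltW q10) (ler_wpM2l (ltW cV0) sG)) _.
rewrite /c.
have -> : 2 - 2 / p = 2 / q by rewrite -[p^-1](addrK q^-1) pq; ring.
set P := _ `^ _; have P0 : 0 < P by rewrite powR_gt0 // ltr0n.
have -> : (q - 1) * ((2 * (P / (p - 1)))^-1 * (P * `|G| ^+ 2)) =
    (q - 1) * (p - 1) * (`|G| ^+ 2 / 2).
  by field; rewrite !gt_eqF ?subr_gt0.
by rewrite conjugate_mulB1 // mul1r.
Qed.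

(** * Regret of mirror descent *)

Section Regret.
Variables (Theta : 'M[R]_(m, k)) (hTheta g : nat -> 'M[R]_(m, k)).
Variables (L eps : nat -> R).
Let N t := eps t + `|g t| ^+ 2.
Hypotheses (eps_ge0 : forall t, 0 <= eps t) (hTheta0 : hTheta 0%N = 0)
  (hThetaS : forall t, hTheta t.+1 = grad (fenchel (mirror p))
     (grad (mirror p) (hTheta t) - (2 * L t / N t) *: g t))
  (gE : forall t, mxdot (Theta - hTheta t) (g t) = - (2 * L t)).

Let z t := grad (mirror p) (hTheta t).

Let z0 : z 0%N = 0.
Proof.
by rewrite /z hTheta0 -[X in grad _ X]grad_fenchel_mirror0 grad_mirrorK.
Qed.

Let zS t : z t.+1 = z t - (2 * L t / N t) *: g t.
Proof. by rewrite /z hThetaS grad_mirrorK. Qed.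

Let hThetaE t : hTheta t = grad (fenchel (mirror p)) (z t).
Proof.
case: t => [|t]; first by rewrite z0 hTheta0 grad_fenchel_mirror0.
by rewrite zS hThetaS.
Qed.

Let N_ge0 t : 0 <= N t.
Proof. by rewrite addr_ge0 ?sqr_ge0. Qed.

(** A vanishing denominator forces g_t = 0, hence L_t = 0 by the gradient
    identity; the quotient L_t^2 / N_t is then 0 as well, so no case is lost in
    the sums below. *)
Lemma loss_eq0 t : N t = 0 -> L t = 0.
Proof.
move=> /eqP; rewrite paddr_eq0 ?sqr_ge0 // sqrf_eq0 normr_eq0.
move=> /andP[_ /eqP g0].
have := gE t; rewrite g0 mxdot_entries big1 => [/esym/eqP|ij _].
  by rewrite oppr_eq0 mulf_eq0 pnatr_eq0 => /eqP.
by rewrite {2}/entries mxE mulr0.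
Qed.

(** The Bregman divergence from hTheta_t to Theta, up to the constant
    f(Theta). *)
Let V t := fenchel (mirror p) (z t) - mxdot Theta (z t).

(** Smoothness at z_t bounds the change of V by
    - 2 eta L_t + eta^2 |g_t|^2 / 2; replacing |g_t|^2 by N_t, the step
    eta = 2 L_t / N_t minimises the result. *)
Lemma potential_decrease t : V t.+1 <= V t - 2 * (L t ^+ 2 / N t).
Proof.
rewrite /V zS -scaleNr mxdotDr mxdotZr.
have := fenchel_mirror_smooth (z t) (- (2 * L t / N t) *: g t).
rewrite -hThetaE mxdotZr normrZ exprMn real_normK ?num_real //.
have := gE t; rewrite mxdotBl.
set P := mxdot Theta (g t); set H := mxdot (hTheta t) (g t).
move=> PH; have {}PH : H = P + 2 * L t by rewrite -[2 * L t]opprK -PH; ring.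
rewrite PH => sm.
have [Nt0|Nt0] := eqVneq (N t) 0.
  by rewrite loss_eq0 // in sm *; move: sm; rewrite Nt0; lra.
have gN : `|g t| ^+ 2 <= N t by rewrite lerDr.
have N0 : 0 < N t by rewrite lt_neqAle eq_sym Nt0 N_ge0.
have e2 : (- (2 * L t / N t)) ^+ 2 * `|g t| ^+ 2 / 2 <= 2 * (L t ^+ 2 / N t).
  apply: le_trans (_ : (- (2 * L t / N t)) ^+ 2 * N t / 2 <= _).
    by rewrite ler_pM2r ?invr_gt0 // ler_wpM2l ?sqr_ge0.
  by rewrite le_eqVlt; apply/orP; left; apply/eqP; field.
have e1 : - (2 * L t / N t) * (P + 2 * L t) =
    - (2 * L t / N t) * P - 4 * (L t ^+ 2 / N t) by field.
by move: sm; rewrite e1; lra.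
Qed.

Lemma sum_scaled_loss_le T :
  \sum_(0 <= t < T) L t ^+ 2 / N t <= mirror p Theta / 2.
Proof.
have V0 : V 0%N = 0.
  rewrite /V z0 mxdot_entries big1 => [|ij _]; last first.
    by rewrite {2}/entries mxE mulr0.
  rewrite subr0 fenchel_mirrorE /sqnorm /psum big1.
    by rewrite powR0 ?mulr0 // mulf_neq0 ?invr_eq0 // gt_eqF.
  by move=> ij _; rewrite /entries mxE normr0 powR0 // gt_eqF.
have VT : V T <= - (2 * \sum_(0 <= t < T) L t ^+ 2 / N t).
  elim: T => [|T IH]; first by rewrite V0 big_geq // mulr0 oppr0.
  rewrite big_nat_recr //=; apply: le_trans (potential_decrease T) _.
  by rewrite mulrDr opprD lerD2r.
have := fenchel_young_mirror Theta (z T); rewrite -fenchel_mirrorE => FY.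
have sumle : 2 * \sum_(0 <= t < T) L t ^+ 2 / N t <= mirror p Theta.
  by rewrite -lerN2; apply: le_trans VT; rewrite /V lerBrDr addrC lerBlDr addrC.
by rewrite ler_pdivlMr // mulrC.
Qed.

Lemma mirror_regret T : \sum_(0 <= t < T) L t <=
  Num.sqrt (mirror p Theta / 2 * \sum_(0 <= t < T) N t).
Proof.
set S := \sum_(0 <= t < T) L t; set M := \sum_(0 <= t < T) N t.
set C := mirror p Theta / 2.
(* Cauchy-Schwarz in optimised form: true for all a, best at a = 2 S / M. *)
have young a : a * S <= C + a ^+ 2 / 4 * M.
  apply: le_trans
    (_ : \sum_(0 <= t < T) (L t ^+ 2 / N t + a ^+ 2 / 4 * N t) <= _).
    rewrite mulr_sumr; apply: ler_sum => t _.
    have [Nt0|Nt0] := eqVneq (N t) 0.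
      by rewrite Nt0 loss_eq0 // !mulr0 expr0n mul0r addr0.
    rewrite -subr_ge0.
    have -> : L t ^+ 2 / N t + a ^+ 2 / 4 * N t - a * L t =
      (L t - a / 2 * N t) ^+ 2 / N t by field.
    by rewrite divr_ge0 ?sqr_ge0.
  by rewrite big_split /= -mulr_sumr lerD2r sum_scaled_loss_le.
have M0 : 0 <= M by apply: sumr_ge0 => t _.
apply: le_trans (ler_norm _) _; rewrite -sqrtr_sqr; apply: ler_wsqrtr.
have [Mz|Mn] := eqVneq M 0.
  suff -> : S = 0 by rewrite Mz mulr0 expr0n.
  rewrite /S big_nat; apply: big1 => t tT; apply: loss_eq0.
  move/eqP: Mz; rewrite /M psumr_eq0 // => /allP /(_ t); rewrite mem_index_iota.
  by move=> /(_ tT) /eqP.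
have Mgt0 : 0 < M by rewrite lt_neqAle eq_sym Mn.
have := young (2 * S / M).
have -> : (2 * S / M) ^+ 2 / 4 * M = S ^+ 2 / M by field.
have -> : 2 * S / M * S = S ^+ 2 / M + S ^+ 2 / M by field.
by rewrite lerD2r ler_pdivrMr.
Qed.

End Regret.

End MirrorPair.

End MatrixMirror.

(** * The loss of the closed loop and the numerical constant *)

(** Moving psi and B to the other side of the inner product gives
    - ||B ((Theta - Q) psi)||^2, which is - 2 J(Q). *)
Lemma mxdot_grad_loss (R : realType) (n1 n2 m k : nat)
    (B : {linear 'M[R]_(m, n2) -> 'M[R]_(n1, n2)})
    (Theta : 'M[R]_(m, k)) (psi : 'M[R]_(k, n2)) (Q : 'M[R]_(m, k)) :
  mxdot (Theta - Q) (grad (loss B Theta psi) Q) = - (2 * loss B Theta psi Q).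
Proof.
pose Bt (V : 'M[R]_(n1, n2)) : 'M[R]_(m, n2) :=
  \matrix_(i, j) mxdot (B (delta_mx i j)) V.
have mxdot_sum (I : finType) (F : I -> 'M[R]_(n1, n2)) V :
    mxdot (\sum_i F i) V = \sum_i mxdot (F i) V.
  by rewrite /mxdot raddf_sum /= mulmx_suml raddf_sum.
have adjB U V : mxdot (B U) V = mxdot U (Bt V).
  rewrite {1}(matrix_sum_delta U) linear_sum mxdot_sum mxdotE.
  apply: eq_bigr => i _.
  rewrite linear_sum mxdot_sum; apply: eq_bigr => j _.
  by rewrite linearZ /= mxdotZl mxE.
rewrite (grad_loss adjB) /loss /frob sqr_sqrtr ?mxdot_ge0 //.
set E := B _.
rewrite [2 * _]mulrC divfK // mxdotC -scaleN1r mxdotZl mulN1r; congr (- _).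
rewrite {2}/E adjB [RHS]mxdotC.
by rewrite /mxdot trmx_mul trmxK -mulmxA mxtrace_mulC mulmxA.
Qed.

(** It suffices that e < 3, and e^(-1/6) >= 1 - 1/6 gives
    e <= (6/5)^6 < 3. *)
Lemma ln_nat_gt1 (R : realType) (n : nat) : (3 <= n)%N -> 1 < ln (n%:R : R).
Proof.
move=> n3; have n0 : 0 < n%:R :> R by rewrite ltr0n (leq_trans _ n3).
rewrite -ltr_expR lnK ?posrE //.
apply: (@lt_le_trans _ _ 3); last by rewrite ler_nat.
have e6 : expR 6^-1 <= 6 / 5 :> R.
  rewrite -[leRHS]invrK -[leLHS]invrK lef_pV2 ?posrE ?invr_gt0 ?expR_gt0 //.
  rewrite -expRN; apply: le_trans (expR_ge1Dx _).
  by rewrite invf_div; lra.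
have -> : (1 : R) = 6%:R * 6^-1 by field.
rewrite expRM_natl; apply: (@le_lt_trans _ _ ((6 / 5) ^+ 6)); last by lra.
by rewrite lerXn2r ?nnegrE ?expR_ge0.
Qed.

(** With l = ln d and p = 1 + 1 / l, the exponent 2 - 2 / p equals
    2 / (1 + l), so that d^(2 - 2/p) = exp (2 l / (1 + l)) <= e^2. *)
Lemma mirror_sparse_le (R : realType) (m k s : nat) (l : R)
    (Theta : 'M[R]_(m, k)) :
  (3 <= m * k)%N ->
  (#|[set ij : 'I_m * 'I_k | Theta ij.1 ij.2 != 0%R]%SET| <= s)%N ->
  l = ln (m * k)%:R ->
  mirror (1 + l^-1) Theta <=
    l * (expR 1 * s%:R `^ (l / (1 + l)) * `|Theta|) ^+ 2 / 2.
Proof.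
move=> d3 sparse lE; set p := 1 + l^-1.
have l1 : 1 < l by rewrite lE; exact: ln_nat_gt1.
have l0 : 0 < l by exact: lt_trans l1.
have d0 : 0 < (m * k)%:R :> R by rewrite ltr0n (leq_trans _ d3).
have p0 : 0 < p by rewrite addr_gt0 ?invr_gt0.
have pV : 2 / p = l / (1 + l) * 2.
  by rewrite /p; field; rewrite !gt_eqF // addr_gt0.
rewrite /mirror lp_norm_sqr.
have dE : (m * k)%:R `^ (2 - 2 / p) <= expR 1 ^+ 2.
  rewrite /powR gt_eqF // -expRM_natl ler_expR mulr1 -lE.
  have -> : 2 - 2 / p = 2 / (1 + l).
    by rewrite pV; field; rewrite gt_eqF // addr_gt0.
  by rewrite mulrAC ler_pdivrMr ?addr_gt0 // ler_pM2l //; lra.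
have sq := sqnorm_le_sparse p0 sparse.
have -> : 2 * (p - 1) = 2 / l by rewrite /p addrAC subrr add0r.
rewrite invf_div mulrA.
have -> : l * (expR 1 * s%:R `^ (l / (1 + l)) * `|Theta|) ^+ 2 / 2 =
  expR 1 ^+ 2 * l / 2 * (s%:R `^ (2 / p) * `|Theta| ^+ 2).
  by rewrite pV [s%:R `^ (_ * 2)]powRrM powR_mulrn ?powR_ge0 //; field.
apply: (ler_pM _ _ _ sq).
- by rewrite !mulr_ge0 ?powR_ge0 ?invr_ge0 // ltW.
- exact: sqnorm_ge0.
- by rewrite ler_pM2r ?invr_gt0 // ler_pM2r.
Qed.

Theorem corollary4 (R : realType) (n1 n2 m k : nat)
    (n1_gt0 : (0 < n1)%N) (n2_gt0 : (0 < n2)%N)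
    (m_gt0 : (0 < m)%N) (k_gt0 : (0 < k)%N)
    (A : {linear 'M[R]_(n1, n2) -> 'M[R]_(n1, n2)})
    (B : {linear 'M[R]_(m, n2) -> 'M[R]_(n1, n2)})
    (K : {linear 'M[R]_(n1, n2) -> 'M[R]_(m, n2)})
    (stable : schur_stable (fun Y : 'M[R]_(n1, n2) => A Y - B (K Y)))
    (Psi : 'M[R]_(n1, n2) -> nat -> 'M[R]_(k, n2))
    (Ud : nat -> 'M[R]_(m, n2)) (Ud_bounded : bounded_fun Ud)
    (Theta : 'M[R]_(m, k))
    (s : nat) (s_gt0 : (0 < s)%N)
    (Theta_sparse : (#|[set ij : 'I_m * 'I_k | Theta ij.1 ij.2 != 0%R]%SET| <= s)%N)
    (d_ge3 : (3 <= m * k)%N)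
    (eps : nat -> R) (eps_ge0 : forall t, 0 <= eps t.+1)
    (eps_bounded : bounded_fun (fun t => eps t.+1 : R^o))
    (X : nat -> 'M[R]_(n1, n2)) (U : nat -> 'M[R]_(m, n2))
    (hTheta : nat -> 'M[R]_(m, k)) (eta : nat -> R) :
  let d : R := (m * k)%:R in
  let p : R := 1 + (ln d)^-1 in
  let f : 'M[R]_(m, k) -> R := mirror p in
  let J (t : nat) : 'M[R]_(m, k) -> R := loss B Theta (Psi (X t) t) in
  forall
    (X_rec : forall t, X t.+1 = A (X t) + B (Theta *m Psi (X t) t + U t))
    (U_def : forall t, U t = - K (X t) - hTheta t *m Psi (X t) t + Ud t)
    (hTheta_init : hTheta 0%N = 0)
    (hTheta_rec : forall t, hTheta t.+1 =
      grad (fenchel f)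
        (grad f (hTheta t) - eta t.+1 *: grad (J t) (hTheta t)))
    (eta_def : forall t, eta t.+1 =
      if eps t.+1 + `|grad (J t) (hTheta t)| ^+ 2 == 0 then 0
      else 2 * J t (hTheta t) / (eps t.+1 + `|grad (J t) (hTheta t)| ^+ 2))
    (T : nat) (T_ge1 : (1 <= T)%N),
  \sum_(0 <= t < T) J t (hTheta t) <=
    expR 1 / 2 * s%:R `^ (ln d / (1 + ln d)) * `|Theta| *
    Num.sqrt (ln d *
      \sum_(0 <= t < T) (eps t.+1 + `|grad (J t) (hTheta t)| ^+ 2)).
Proof.
move=> d p f J X_rec U_def hTheta_init hTheta_rec eta_def T T_ge1.
set l := ln d; have l1 : 1 < l by exact: ln_nat_gt1.
have l0 : 0 < l by exact: lt_trans l1.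
pose q : R := 1 + l.
have p1 : 1 < p by rewrite /p ltrDl invr_gt0.
have q2 : 2 < q by rewrite /q; lra.
have pq : p^-1 + q^-1 = 1.
  by rewrite /p /q -/l; field; rewrite !gt_eqF ?addr_gt0.
have d0 : (0 < m * k)%N by apply: leq_trans d_ge3.
pose g t := grad (J t) (hTheta t); pose L t := J t (hTheta t).
have etaE t : eta t.+1 = 2 * L t / (eps t.+1 + `|g t| ^+ 2).
  rewrite eta_def -/(g t) -/(L t); case: ifP => [/eqP ->|//].
  by rewrite invr0 mulr0.
have rec t : hTheta t.+1 = grad (fenchel (mirror p))
    (grad (mirror p) (hTheta t) - (2 * L t / (eps t.+1 + `|g t| ^+ 2)) *: g t).
  by rewrite hTheta_rec etaE.
have gE t : mxdot (Theta - hTheta t) (g t) = - (2 * L t).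
  exact: mxdot_grad_loss.
apply: le_trans (mirror_regret p1 q2 pq d0 eps_ge0 hTheta_init rec gE T) _.
set M := \sum_(0 <= t < T) _.
have M0 : 0 <= M by apply: sumr_ge0 => t _; rewrite addr_ge0 ?sqr_ge0.
set b := expR 1 / 2 * _ * _.
have b0 : 0 <= b by rewrite !mulr_ge0 ?powR_ge0 ?expR_ge0 ?invr_ge0.
rewrite -[b]ger0_norm // -sqrtr_sqr -sqrtrM ?sqr_ge0 //; apply: ler_wsqrtr.
rewrite mulrA ler_wpM2r //.
have bound := mirror_sparse_le d_ge3 Theta_sparse (erefl l).
have -> : b ^+ 2 * l =
    l * (expR 1 * s%:R `^ (l / (1 + l)) * `|Theta|) ^+ 2 / 2 / 2.
  by rewrite /b -/l; field.
by rewrite ler_pM2r ?invr_gt0.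
Qed.
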